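(* Let $N\ge3$, let $\Omega=\mathbb{R}^N\setminus\mathcal{O}$ be a punctured or an exterior domain, and let $V$ be a nonnegative function on $\Omega$ satisfying $$\liminf_{|x|\to+\infty}V(x)|x|^2>\frac{(N-2)^2}{4}.$$ Then the problem $$-\Delta u=V(x)u\ \text{ in }\Omega,\qquad u\ge0\ \text{ on }\partial\Omega$$ has no positive supersolution.
   Context: A punctured or exterior domain is a set $\Omega=\mathbb{R}^N\setminus\mathcal{O}$ where $\mathcal{O}$ is a bounded, closed, smooth subset of $\mathbb{R}^N$; typical examples are $\mathbb{R}^N\setminus\{0\}$ and $\mathbb{R}^N\setminus\overline{B}_R(0)$, with $B_R(0)$ the ball of radius $R$ centered at the origin. A function $u\in C^2(\Omega)$ is a positive supersolution of the problem if $u(x)>0$ and $-\Delta u(x)\ge V(x)u(x)$ for all $x\in\Omega$. *)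

(* Defs.v *)
From mathcomp Require Import all_boot all_order all_algebra.
From mathcomp Require Import all_classical all_reals all_analysis.

Set Implicit Arguments.
Unset Strict Implicit.
Unset Printing Implicit Defensive.

Import Order.TTheory GRing.Theory Num.Theory.
Import numFieldNormedType.Exports.

Local Open Scope classical_set_scope.
Local Open Scope ring_scope.

(* R^n is the type 'rV[R]_n. The library norm `|x| on it is the sup norm:
   it yields the usual topology and bounded sets, but the |x| of the
   statement is Euclidean. *)
Definition enorm {R : realType} {n : nat} (x : 'rV[R]_n) : R :=
  Num.sqrt (\sum_(i < n) x 0 i ^+ 2).

(* Neighbourhoods of |x| = +oo. When O is bounded, the complement of O is
   one of them, so that a limit along this filter only depends on the values
   of a function on that complement. *)
Definition enorm_infty (R : realType) (n : nat) : set_system 'rV[R]_n :=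
  [set A | exists M : R, forall x, M < enorm x -> A x].

Definition partial {R : realType} {n : nat} (i : 'I_n) (f : 'rV[R]_n -> R) :
    'rV[R]_n -> R :=
  fun x => 'D_(delta_mx 0 i) f x.

(* f is of class C^k on U. The set U is meant to be open, in which case this
   only depends on the values of f on U. *)
Fixpoint classC {R : realType} {n : nat} (k : nat) (U : set 'rV[R]_n)
    (f : 'rV[R]_n -> R) : Prop :=
  (forall x, U x -> {for x, continuous f}) /\
  if k is k'.+1 then
    forall i : 'I_n,
      (forall x, U x -> derivable f x (delta_mx 0 i)) /\
      classC k' U (partial i f)
  else True.

Definition smooth_map {R : realType} {n m : nat} (U : set 'rV[R]_n)
    (phi : 'rV[R]_n -> 'rV[R]_m) : Prop :=
  forall (j : 'I_m) (k : nat), classC k U (fun x => phi x 0 j).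

Definition smooth_diffeo {R : realType} {n : nat} (U W : set 'rV[R]_n)
    (phi psi : 'rV[R]_n -> 'rV[R]_n) : Prop :=
  [/\ open U /\ open W,
      (forall x, U x -> W (phi x)) /\ (forall y, W y -> U (psi y)),
      (forall x, U x -> psi (phi x) = x) /\ (forall y, W y -> phi (psi y) = y)
    & smooth_map U phi /\ smooth_map W psi].

(* R^d x {0} inside R^n if b is false, and (R^(d-1) x [0, +oo)) x {0} if b is
   true and 0 < d. *)
Definition flat_model {R : realType} {n : nat} (d : nat) (b : bool) :
    set 'rV[R]_n :=
  [set y | (forall i : 'I_n, (d <= i)%N -> y 0 i = 0) /\
           (b -> forall i : 'I_n, i.+1 = d -> 0 <= y 0 i)].

(* O is a C^oo embedded submanifold of R^n, with or without boundary, whose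
   components may have different dimensions. This covers both kinds of
   obstacles: closures of smooth domains such as closed balls (dimension n,
   with boundary) and points (dimension 0). *)
Definition smooth_subset {R : realType} {n : nat} (O : set 'rV[R]_n) : Prop :=
  forall p, O p ->
    exists (d : nat) (b : bool) (U W : set 'rV[R]_n)
           (phi psi : 'rV[R]_n -> 'rV[R]_n),
      [/\ (d <= n)%N, U p, smooth_diffeo U W phi psi
        & forall x, U x -> (O x <-> flat_model d b (phi x))].

Definition punctured_or_exterior {R : realType} {n : nat}
    (Omega : set 'rV[R]_n) : Prop :=
  exists O : set 'rV[R]_n,
    [/\ bounded_set O, closed O, smooth_subset O & Omega = ~` O].

Definition laplacian {R : realType} {n : nat} (u : 'rV[R]_n -> R) :
    'rV[R]_n -> R :=
  fun x => \sum_(i < n) partial i (partial i u) x.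

(* As u is only defined on Omega, the condition u >= 0 on the boundary of
   Omega does not enter the definition of a supersolution. *)
Definition positive_supersolution {R : realType} {n : nat}
    (Omega : set 'rV[R]_n) (V u : 'rV[R]_n -> R) : Prop :=
  classC 2 Omega u /\
  forall x, Omega x -> 0 < u x /\ - laplacian u x >= V x * u x.

(* Main.v *)
Require Import Defs.
From mathcomp Require Import all_boot all_order all_algebra.
From mathcomp Require Import all_classical all_reals all_analysis.
From mathcomp Require Import ring lra.

(** Put c0 = (N-2)^2/4. By the hypothesis on the lower
    limit there is c > c0 with V(x) |x|^2 >= c for all large |x|, so a positive
    supersolution satisfies -Delta u >= (c / |x|^2) u near infinity. The
    constant c0 is the threshold of oscillation: for b > 0, the radial function

      w(x) = |x|^(-(N-2)/2) sin(b ln(|x|^2 / rho))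

    solves -Delta w = ((c0 + 4 b^2) / |x|^2) w, and it is positive in the
    annulus rho < |x|^2 < rho exp(pi/b) and zero on its boundary. Choose b with
    c0 + 4 b^2 < c, and rho so large that the closed annulus lies in the region
    where the differential inequality for u holds.

    Instead of integrating u against w, compare the two pointwise. The quotient
    w / u attains its maximum t over the closed annulus; t is positive, so the
    maximum is at an interior point x0, where t u - w has a local minimum equal
    to 0. Hence Delta (t u - w)(x0) >= 0, whereas

      Delta (t u - w)(x0) <= - (c - c0 - 4 b^2) w(x0) / |x0|^2 < 0.

    [touching_radial_below] is the second derivative test at the point of
    contact, [wave_ode] the equation for w, [radial_barrier_no_supersolution]
    the comparison argument, and [no_supersolution_hardy_constant] the choice
    of w. Radial functions are written as functions of s = |x|^2, because s is
    a quadratic polynomial along every line. *)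

Import Order.TTheory GRing.Theory Num.Theory.
Import numFieldNormedType.Exports.
Local Open Scope classical_set_scope.
Local Open Scope ring_scope.

(** * Second derivative test *)

(** If l were negative, f' would vanish at a and be negative just after a, so f
    would decrease strictly to the right of a. *)
Lemma second_derivative_ge0 {R : realType} (f f' : R -> R) (a l : R) :
  (\forall x \near a, is_derive (x : R) 1 f (f' x)) -> is_derive a 1 f' l ->
  (\forall x \near a, f a <= f x) -> 0 <= l.
Proof.
move=> df ddf fmin; rewrite leNgt; apply/negP => l0.
have [e /= e0 He] : exists2 e : R, 0 < e & forall x, `|a - x| < e ->
    is_derive x 1 f (f' x) /\ f a <= f x.
  have : \forall x \near a, is_derive (x : R) 1 f (f' x) /\ f a <= f x.
    by apply: filterI.
  by move=> /nbhs_ballP[e /= e0 He]; exists e => // x xe; have := He x xe.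
have f'a0 : f' a = 0.
  have aI : a \in `]a - e, a + e[ by rewrite in_itv /=; apply/andP; split; lra.
  have near_a t : t \in `]a - e, a + e[ -> `|a - t| < e.
    by rewrite in_itv /= ltr_norml => /andP[? ?]; apply/andP; split; lra.
  have d0 : is_derive a 1 f 0.
    apply: (@derive1_at_min _ f (a - e) (a + e) a) => //; first by lra.
      by move=> t /near_a/He[[]].
    by move=> t /near_a/He[].
  have [da _] := He a (near_a _ aI).
  by rewrite -(@derive_val _ _ _ _ _ _ _ da) (@derive_val _ _ _ _ _ _ _ d0).
(* The difference quotient of f' at a tends to l < 0, and f' a = 0. *)
have [d /= d0 Hd] : exists2 d : R, 0 < d & forall h, 0 < h -> h < d ->
    f' (h + a) < 0.
  have cv : h^-1 *: ((f' \o shift a) (h *: 1) - f' a) @[h --> 0^'] --> l.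
    by rewrite -(@derive_val _ _ _ _ _ _ _ ddf); apply: ex_derive.
  have : \forall h \near 0^', h^-1 *: ((f' \o shift a) (h *: 1) - f' a) < 0.
    exact: (cvgr_lt l cv).
  rewrite near_withinE => /nbhs_ballP[d /= d0 Hd]; exists d => // h h0 hd.
  have := Hd h; rewrite /ball /= sub0r normrN gtr0_norm // => /(_ hd).
  rewrite gt_eqF // => /(_ isT); rewrite f'a0 subr0.
  by rewrite /GRing.scale /= mulr1 pmulr_rlt0 // invr_gt0.
pose h := Num.min d e / 2.
have hm : 0 < Num.min d e by rewrite lt_min d0 e0.
have h0 : 0 < h by rewrite /h; lra.
have [hd he] : h < d /\ h < e.
  have : h < Num.min d e by rewrite /h; lra.
  by rewrite lt_min => /andP.
have near_h x : a <= x -> x <= a + h -> `|a - x| < e.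
  by move=> ax xh; rewrite ltr_norml; apply/andP; split; lra.
have [|x||c] := @MVT _ f f' a (a + h).
- by lra.
- rewrite in_itv /= => /andP[/ltW ax /ltW xh].
  by have [] := He x (near_h _ ax xh).
- apply: derivable_within_continuous => x; rewrite in_itv /= => /andP[ax xh].
  by have [[]] := He x (near_h _ ax xh).
rewrite in_itv /= => /andP[ac ch] E.
have [_ fah] : is_derive (a + h) 1 f (f' (a + h)) /\ f a <= f (a + h).
  by apply: He; apply: near_h; lra.
have : f' c < 0.
  by have := Hd (c - a); rewrite subrK; apply; lra.
by move=> f'c; have : f' c * (a + h - a) < 0; [rewrite nmulr_rlt0 //; lra | lra].
Qed.

(** * Squared Euclidean norm and coordinate lines *)

Section Line.
Context {R : realType} {n : nat}.
Implicit Types (x v : 'rV[R]_n) (f : 'rV[R]_n -> R).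

Lemma is_derive_line f x v (h : R) : derivable f (h *: v + x) v ->
  is_derive h 1 (fun k => f (k *: v + x)) ('D_v f (h *: v + x)).
Proof.
have E : (fun k : R => k^-1 *: (((fun k => f (k *: v + x)) \o shift h) (k *: 1)
      - f (h *: v + x))) =
    (fun k : R => k^-1 *: ((f \o shift (h *: v + x)) (k *: v) - f (h *: v + x))).
  apply/funext => k /=.
  have -> : k *: (1 : R) = k by exact: mulr1.
  by rewrite scalerDl addrA.
move=> df; split; first by rewrite /derivable E.
by rewrite /derive E.
Qed.

Lemma cvg_line x v : (fun h : R => h *: v + x) @ 0 --> x.
Proof.
have E : x = 0 *: v + x by rewrite scale0r add0r.
rewrite {2}E; apply: cvgD; last exact: cvg_cst.
by apply: cvgZr_tmp; exact: cvg_id.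
Qed.

Definition sqnorm x : R := \sum_(i < n) x 0 i ^+ 2.

Lemma sqnorm_line x (i : 'I_n) (h : R) :
  sqnorm (h *: delta_mx 0 i + x) = sqnorm x + 2 * x 0 i * h + h ^+ 2.
Proof.
rewrite /sqnorm (bigD1 i) //= [in RHS](bigD1 i) //= !mxE !eqxx mulr1.
under eq_bigr => j ji do rewrite !mxE eqxx (negbTE ji) mulr0 add0r.
ring.
Qed.

Lemma continuous_sqnorm : continuous sqnorm.
Proof.
apply: continuous_big => [|i _]; first exact: add_continuous.
move=> x; have cx := @coord_continuous R 1 n 0 i x.
exact: (cvgM cx cx).
Qed.

Lemma is_derive_sqnorm_line x (i : 'I_n) (h : R) :
  is_derive h 1 (fun k => sqnorm (k *: delta_mx 0 i + x)) (2 * (x 0 i + h)).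
Proof.
have -> : (fun k => sqnorm (k *: delta_mx 0 i + x)) =
    cst (sqnorm x) + (2 * x 0 i) *: id + (@id R) ^+ 2.
  by apply/funext => k; rewrite sqnorm_line !fctE.
have dlin := is_deriveZ (2 * x 0 i) (is_derive_id h (1 : R)).
have dsq := is_deriveX 2 (is_derive_id h (1 : R)).
have dpoly := is_deriveD (is_deriveD (is_derive_cst (sqnorm x) h 1) dlin) dsq.
by apply: (is_derive_eq dpoly); rewrite /GRing.scale /=; ring.
Qed.

End Line.

Lemma sqr_entry_le_sqnorm {R : realType} {n : nat} (x : 'rV[R]_n) i :
  x 0 i ^+ 2 <= sqnorm x.
Proof.
by rewrite /sqnorm (bigD1 i) //= lerDl sumr_ge0 // => j _; rewrite sqr_ge0.
Qed.

Lemma sqnorm_le {R : realType} {n : nat} (x : 'rV[R]_n) :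
  sqnorm x <= n%:R * `|x| ^+ 2.
Proof.
rewrite /sqnorm mulr_natl -[X in _ *+ X]card_ord -sumr_const.
apply: ler_sum => i _; rewrite -[leLHS]real_normK ?num_real //.
rewrite lerXn2r ?nnegrE //.
by rewrite [`|x|]mx_normrE; apply: (le_bigmax _ (fun ij => `|x ij.1 ij.2|) (0, i)).
Qed.

Lemma compact_annulus {R : realType} {n : nat} (r r' : R) :
  compact [set x : 'rV[R]_n | r <= sqnorm x <= r'].
Proof.
apply: bounded_closed_compact.
  exists (1 + r'); split => [|M M1 x /= /andP[_ xr]]; first exact: num_real.
  have M0 : 0 < M.
    have : 0 <= sqnorm x by apply: sumr_ge0 => i _; exact: sqr_ge0.
    by lra.
  rewrite [`|x|]mx_normrE; apply/bigmax_leP; split => [|[i j] _ /=].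
    exact: ltW.
  rewrite ord1; have := sqr_entry_le_sqnorm x j.
  rewrite -[leLHS]real_normK ?num_real // => H; nra.
have -> : [set x : 'rV[R]_n | r <= sqnorm x <= r'] =
    sqnorm @^-1` [set s | r <= s] `&` sqnorm @^-1` [set s | s <= r'].
  by apply/seteqP; split => x /= => [/andP//|[-> ->]].
have csq := @continuous_sqnorm R n.
by apply: closedI; apply: preimage_closed => [x _|]; [exact: csq | exact: closed_ge
  | exact: csq | exact: closed_le].
Qed.

(** * Contact with a radial function *)

(** Along each line through x in a coordinate direction, t u - g(|.|^2) has a
    local minimum at x, so that its second derivative there is nonnegative;
    the sum over the directions is the claim, because the Laplacian of
    g(|x|^2) is 2 n g' + 4 |x|^2 g''. *)
Lemma touching_radial_below {R : realType} {n : nat} (U : set 'rV[R]_n)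
    (u : 'rV[R]_n -> R) (x : 'rV[R]_n) (g g' : R -> R) (g2 t : R) :
  open U -> U x -> classC 2 U u ->
  (\forall s \near sqnorm x, is_derive (s : R) 1 g (g' s)) ->
  is_derive (sqnorm x) 1 g' g2 ->
  (\forall y \near x, g (sqnorm y) <= t * u y) -> g (sqnorm x) = t * u x ->
  2 * n%:R * g' (sqnorm x) + 4 * sqnorm x * g2 <= t * laplacian u x.
Proof.
move=> oU Ux [_ Hu] dg ddg le_gu eq_gu.
suff H (i : 'I_n) : 2 * g' (sqnorm x) + 4 * x 0 i ^+ 2 * g2 <=
    t * partial i (partial i u) x.
  have -> : 2 * n%:R * g' (sqnorm x) + 4 * sqnorm x * g2 =
      \sum_(i < n) (2 * g' (sqnorm x) + 4 * x 0 i ^+ 2 * g2).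
    rewrite big_split /= sumr_const card_ord -mulr_suml -mulr_sumr.
    by rewrite -mulr_natl /sqnorm; ring.
  by rewrite /laplacian mulr_sumr; apply: ler_sum => i _.
have [du [_ Hpu]] := Hu i; have [dpu _] := Hpu i.
set v : 'rV[R]_n := delta_mx 0 i in du dpu *.
have x0 : 0 *: v + x = x by rewrite scale0r add0r.
have line P : (\forall y \near x, P y) -> \forall h \near (0 : R), P (h *: v + x).
  by move=> /(cvg_line x v).
rewrite -subr_ge0.
pose q (h : R) := sqnorm (h *: v + x).
have dq (h : R) : is_derive h 1 q (2 * (x 0 i + h)).
  exact: is_derive_sqnorm_line.
apply: (@second_derivative_ge0 _
  (t *: (fun h : R => u (h *: v + x)) - (g \o q))
  (t *: (fun h : R => partial i u (h *: v + x)) -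
     (g' \o q) * (fun h : R => 2 * (x 0 i + h))) 0).
- have /line nearU := open_nbhs_nbhs (conj oU Ux).
  have /line nearg : \forall y \near x,
      is_derive (sqnorm y : R) 1 g (g' (sqnorm y)).
    by have := continuous_sqnorm x _ dg.
  near=> h.
  have dgh : is_derive (q h) 1 g (g' (q h)) by near: h.
  have duh : is_derive h 1 (fun k => u (k *: v + x)) (partial i u (h *: v + x)).
    by apply: is_derive_line; apply: du; near: h.
  have dcomp := is_derive1_comp dgh (dq h).
  exact: (is_deriveB (is_deriveZ t duh) dcomp).
- have ddg0 : is_derive (q 0) 1 g' g2 by rewrite /q x0.
  have dpu0 : is_derive (0 : R) 1 (fun k => partial i u (k *: v + x))
      (partial i (partial i u) x).
    by rewrite -{2}x0; apply: is_derive_line; apply: dpu; rewrite x0.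
  have dlin : is_derive (0 : R) 1 (fun h : R => 2 * (x 0 i + h)) 2.
    have -> : (fun h : R => 2 * (x 0 i + h)) = (2 : R) *: (cst (x 0 i) + id) by [].
    have daff := is_deriveD (is_derive_cst (x 0 i) (0 : R) 1)
      (is_derive_id (0 : R) 1).
    by apply: (is_derive_eq (is_deriveZ 2 daff)); rewrite /GRing.scale /=; ring.
  have dcomp := is_derive1_comp ddg0 (dq 0).
  apply: (is_derive_eq (is_deriveB (is_deriveZ t dpu0) (is_deriveM dcomp dlin))).
  by rewrite /GRing.scale /= /q x0; ring.
- have near_le := line _ le_gu; near=> h.
  rewrite !fctE /= /q x0.
  have -> : t *: u x - g (sqnorm x) = 0 by rewrite eq_gu subrr.
  rewrite subr_ge0; near: h; exact: near_le.
Unshelve. all: by end_near.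
Qed.

(** * Oscillating radial solutions *)

Section Wave.
Context {R : realType}.

(** In the variable ln s - T these are the solutions of a second-order linear
    equation with constant coefficients and characteristic roots -a + b i and
    -a - b i; the family is closed under s d/ds, which acts linearly on (p, q). *)
Definition wave (a b T p q s : R) : R :=
  expR (- a * (ln s - T)) *
  (p * cos (b * (ln s - T)) + q * sin (b * (ln s - T))).

Lemma is_derive_wave (a b T p q s : R) : 0 < s ->
  is_derive s 1 (wave a b T p q)
    (s^-1 * wave a b T (b * q - a * p) (- b * p - a * q) s).
Proof.
move=> s0; have dln := is_derive1_ln s0.
pose l := (@ln R : R -> R) - cst T.
have dl k : is_derive s 1 (k *: l) (k * s^-1).
  apply: (is_derive_eq (is_deriveZ k (is_deriveB dln (is_derive_cst T s 1)))).
  by rewrite /GRing.scale /= subr0.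
have dE := is_derive1_comp (is_derive_expR ((- a *: l) s)) (dl (- a)).
have dC := is_derive1_comp (is_derive_cos ((b *: l) s)) (dl b).
have dS := is_derive1_comp (is_derive_sin ((b *: l) s)) (dl b).
have -> : wave a b T p q = (expR \o (- a *: l)) *
    (p *: (cos \o (b *: l)) + q *: (sin \o (b *: l))) by [].
have dosc := is_deriveD (is_deriveZ p dC) (is_deriveZ q dS).
apply: (is_derive_eq (is_deriveM dE dosc)).
by rewrite /wave !fctE /= /GRing.scale /=; ring.
Qed.

Lemma is_derive2_wave (a b T p q s : R) : 0 < s ->
  let p' := b * q - a * p in let q' := - b * p - a * q in
  is_derive s 1 (fun r => r^-1 * wave a b T p' q' r)
    (s^-1 ^+ 2 * (wave a b T (b * q' - a * p') (- b * p' - a * q') s -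
                  wave a b T p' q' s)).
Proof.
move=> s0 p' q'.
have dw := is_derive_wave a b T p' q' s s0.
have dV : is_derive s 1 (fun r : R => r^-1) (- s ^- 2).
  have dinv := is_deriveV (lt0r_neq0 s0 : id s != 0) (is_derive_id s (1 : R)).
  by apply: (is_derive_eq dinv); rewrite /GRing.scale /= mulr1.
have -> : (fun r => r^-1 * wave a b T p' q' r) =
  (fun r : R => r^-1) * wave a b T p' q' by [].
apply: (is_derive_eq (is_deriveM dV dw)).
by rewrite /GRing.scale /= -exprVn; ring.
Qed.

(** For g = wave a b T 0 1 the left-hand side is 2 n g' + 4 s g'', that is, the
    Laplacian of g(|x|^2) at |x|^2 = s. In the variable ln s this operator has
    a first-order term, which the choice of a cancels against the exponential
    factor of g; only multiples of the sine remain. *)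
Lemma wave_ode (n b T s : R) : 0 < s ->
  let a := (n - 2) / 4 in
  2 * n * (s^-1 * wave a b T b (- a) s) +
  4 * s * (s^-1 ^+ 2 * (wave a b T (b * - a - a * b) (- b * b - a * - a) s -
     wave a b T b (- a) s)) =
  - ((n - 2) ^+ 2 / 4 + 4 * b ^+ 2) * (s^-1 * wave a b T 0 1 s).
Proof.
by move=> s0 a; rewrite /wave /a; field; rewrite gt_eqF.
Qed.

End Wave.

(** * Comparison with a supersolution *)

(** A radial bump that vanishes on both ends of an annulus and is a strict
    subsolution wherever it is positive excludes supersolutions: the maximum
    of g(|x|^2) / u over the annulus is positive, hence interior, and there a
    multiple of u touches the bump from above, against
    [touching_radial_below]. *)
Lemma radial_barrier_no_supersolution {R : realType} {n : nat}
    (U : set 'rV[R]_n) (V u : 'rV[R]_n -> R) (g g' g2 : R -> R)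
    (c rho m rho' : R) :
  (0 < n)%N -> open U -> 0 < rho -> rho < m < rho' ->
  (forall s : R, 0 < s -> is_derive s 1 g (g' s)) ->
  (forall s : R, 0 < s -> is_derive s 1 g' (g2 s)) ->
  g rho = 0 -> 0 < g m -> g rho' = 0 ->
  (forall s, 0 < s -> 0 < g s ->
    - c * (s^-1 * g s) < 2 * n%:R * g' s + 4 * s * g2 s) ->
  (forall x, rho <= sqnorm x <= rho' -> U x /\ c <= V x * sqnorm x) ->
  ~ positive_supersolution U V u.
Proof.
move=> n0 oU rho0 /andP[rhom mrho'] dg ddg g_rho gm g_rho' strict ann [Cu Hu].
pose K := [set x : 'rV[R]_n | rho <= sqnorm x <= rho'].
have KU x : K x -> U x by move=> /ann[].
have m0 : 0 < m by exact: lt_trans rhom.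
(* A point of the annulus at which the bump is positive. *)
pose x1 : 'rV[R]_n := Num.sqrt m *: delta_mx 0 (Ordinal n0) + 0.
have Sx1 : sqnorm x1 = m.
  rewrite /x1 sqnorm_line mxE mulr0 mul0r addr0 sqr_sqrtr ?ltW //.
  by rewrite /sqnorm big1 ?add0r // => j _; rewrite mxE expr0n.
have Kx1 : K x1 by rewrite /K /= Sx1 !ltW.
have [x0 /set_mem Kx0 x0max] : exists2 x0, x0 \in K &
    forall y, y \in K -> g (sqnorm y) / u y <= g (sqnorm x0) / u x0.
  apply: (@EVT_max_rV _ _ (fun y => g (sqnorm y) / u y)).
  - by exists x1.
  - exact: compact_annulus.
  apply: continuous_in_subspaceT => y /set_mem Ky.
  have Sy0 : 0 < sqnorm y by case/andP: Ky => /(lt_le_trans rho0).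
  have cg : {for sqnorm y, continuous g}.
    by apply: differentiable_continuous; apply/derivable1_diffP;
      have [] := dg _ Sy0.
  have cgS : {for y, continuous (g \o sqnorm)}.
    exact: (continuous_comp (@continuous_sqnorm R n y) cg).
  apply: continuousM cgS _.
  apply: continuousV; last by apply: Cu.1; exact: KU.
  by rewrite gt_eqF //; have [] := Hu y (KU _ Ky).
pose t := g (sqnorm x0) / u x0.
have ux0 : 0 < u x0 by have [] := Hu x0 (KU _ Kx0).
have t0 : 0 < t.
  apply: lt_le_trans (x0max x1 (mem_set Kx1)); rewrite Sx1 divr_gt0 //.
  by have [] := Hu x1 (KU _ Kx1).
have tE : g (sqnorm x0) = t * u x0 by rewrite divfK ?gt_eqF.
have gx0 : 0 < g (sqnorm x0) by rewrite tE mulr_gt0.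
have /andP[x0l x0r] : rho < sqnorm x0 < rho'.
  have /andP[] := Kx0; rewrite !le_eqVlt => /orP[/eqP E|->].
    by exfalso; move: gx0; rewrite -E g_rho ltxx.
  by move=> /orP[/eqP E|-> //]; exfalso; move: gx0; rewrite E g_rho' ltxx.
have S0 : 0 < sqnorm x0 by exact: lt_trans x0l.
have [_ Vx0] := ann _ Kx0.
have [_ sup] := Hu x0 (KU _ Kx0).
have touch : 2 * n%:R * g' (sqnorm x0) + 4 * sqnorm x0 * g2 (sqnorm x0) <=
    t * laplacian u x0.
  apply: (@touching_radial_below _ _ U u x0 g g') (ddg _ S0) _ tE => //.
  - exact: KU.
  - by near=> s; apply: dg; near: s; exact: lt_nbhsr.
  near=> y.
  have yl : rho < sqnorm y.
    by near: y; exact: (@continuous_sqnorm R n x0 _ (lt_nbhsr x0l)).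
  have yr : sqnorm y < rho'.
    by near: y; exact: (@continuous_sqnorm R n x0 _ (lt_nbhsl x0r)).
  have Ky : K y by rewrite /K /= !ltW.
  have uy : 0 < u y by have [] := Hu y (KU _ Ky).
  by rewrite -ler_pdivrMr //; exact: (x0max y (mem_set Ky)).
(* At x0 the supersolution inequality bounds t Delta u from above by
   - c g / |x0|^2, which is strictly below the Laplacian of the bump. *)
have := lt_le_trans (strict _ S0 gx0) touch; apply/negP; rewrite -leNgt.
rewrite mulNr lerNr -mulrN; apply: le_trans (ler_wpM2l (ltW t0) sup).
rewrite -subr_ge0 tE.
have -> : t * (V x0 * u x0) - c * ((sqnorm x0)^-1 * (t * u x0)) =
    (V x0 * sqnorm x0 - c) * ((sqnorm x0)^-1 * (t * u x0)).
  by field; rewrite gt_eqF.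
apply: mulr_ge0; first by rewrite subr_ge0.
by apply: ltW; rewrite -tE mulr_gt0 // invr_gt0.
Unshelve. all: by end_near.
Qed.

(** The bump is one positive half-period of the oscillating solution
    |x|^(-(n-2)/2) sin(b ln(|x|^2 / rho)), up to a constant factor; b > 0 is so
    small that the constant (n-2)^2/4 + 4 b^2 of its equation is still below c. *)
Lemma no_supersolution_hardy_constant {R : realType} {n : nat}
    (U : set 'rV[R]_n) (V u : 'rV[R]_n -> R) (c rho : R) :
  (0 < n)%N -> open U -> 0 < rho -> (n%:R - 2) ^+ 2 / 4 < c ->
  (forall x, rho <= sqnorm x -> U x /\ c <= V x * sqnorm x) ->
  ~ positive_supersolution U V u.
Proof.
move=> n0 oU rho0 hc far.
pose a : R := (n%:R - 2) / 4.
pose b := Num.sqrt (c - (n%:R - 2) ^+ 2 / 4) / 4.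
have b0 : 0 < b by rewrite divr_gt0 // sqrtr_gt0 subr_gt0.
have bc : (n%:R - 2) ^+ 2 / 4 + 4 * b ^+ 2 < c.
  rewrite /b expr_div_n sqr_sqrtr; last by rewrite subr_ge0 ltW.
  lra.
pose T := ln rho.
pose g := wave a b T 0 1.
have gE s : g s = expR (- a * (ln s - T)) * sin (b * (ln s - T)).
  by rewrite /g /wave mul0r add0r mul1r.
have pib : 0 < pi / b by rewrite divr_gt0 // pi_gt0.
(* The phase b (ln s - ln rho) runs from 0 to pi on this range of s, and
   equals pi/2 at the intermediate point. *)
apply: (@radial_barrier_no_supersolution _ _ U V u g
  (fun s => s^-1 * wave a b T b (- a) s)
  (fun s => s^-1 ^+ 2 * (wave a b T (b * - a - a * b) (- b * b - a * - a) s -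
     wave a b T b (- a) s))
  c rho (expR (T + pi / b / 2)) (expR (T + pi / b)) n0 oU rho0).
- by rewrite -[X in X < _ < _]lnK // !ltr_expR -/T; apply/andP; split; lra.
- move=> s s0; have := is_derive_wave a b T 0 1 s s0.
  by rewrite !mulr0 !mulr1 subr0 sub0r.
- move=> s s0; have := is_derive2_wave a b T 0 1 s s0.
  by rewrite !mulr0 !mulr1 subr0 sub0r.
- by rewrite gE subrr !mulr0 sin0 mulr0.
- rewrite gE mulr_gt0 ?expR_gt0 // expRK.
  have -> : b * (T + pi / b / 2 - T) = pi / 2 by field; rewrite gt_eqF.
  by rewrite sin_pihalf.
- rewrite gE expRK.
  have -> : b * (T + pi / b - T) = pi by field; rewrite gt_eqF.
  by rewrite sinpi mulr0.
- move=> s s0 gs; rewrite wave_ode // -/g.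
  by rewrite ltr_pM2r ?ltrN2 // mulr_gt0 ?invr_gt0.
by move=> x /andP[/far].
Qed.

Theorem theorem2p1 (R : realType) (N : nat) (Omega : set 'rV[R]_N)
    (V : 'rV[R]_N -> R)
    (hN : (3 <= N)%N)
    (hOmega : punctured_or_exterior Omega)
    (hV : forall x, Omega x -> 0 <= V x)
    (hliminf : (((N%:R - 2) ^+ 2 / 4)%:E <
       limf_einf (fun x => (V x * enorm x ^+ 2)%:E) (@enorm_infty R N))%E) :
  ~ exists u : 'rV[R]_N -> R, positive_supersolution Omega V u.
Proof.
case: hOmega => O [[B [_ HB]] cO _ ->] [u].
move: hliminf; rewrite limf_einfE => /ereal_sup_gt[_ [A [M HM] <-]] hA.
(* The infimum over a neighbourhood of infinity may be +oo, in which case any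
   real number above the threshold serves as c. *)
have [c hc HA] : exists2 c : R, (N%:R - 2) ^+ 2 / 4 < c &
    forall x, A x -> c <= V x * enorm x ^+ 2.
  have lbA x : A x ->
      (ereal_inf [set (V y * enorm y ^+ 2)%:E | y in A] <= (V x * enorm x ^+ 2)%:E)%E.
    by move=> Ax; apply: ereal_inf_lbound; exists x.
  case: (ereal_inf _) hA lbA => [c| |] //.
    by rewrite lte_fin => hc lbA; exists c => // x /lbA; rewrite lee_fin.
  move=> _ lbA; exists ((N%:R - 2) ^+ 2 / 4 + 1); first by rewrite ltrDl.
  by move=> x /lbA.
have sqB : 0 <= N%:R * (B + 1) ^+ 2 :> R by rewrite mulr_ge0 ?sqr_ge0.
have sqM := sqr_ge0 M.
have esq x : enorm x ^+ 2 = sqnorm x.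
  by rewrite sqr_sqrtr // sumr_ge0 // => i _; exact: sqr_ge0.
(* O lies in the sup-norm ball of radius B + 1, hence in the Euclidean ball of
   squared radius N (B + 1)^2. *)
apply: (@no_supersolution_hardy_constant _ _ _ _ _ c
  (N%:R * (B + 1) ^+ 2 + M ^+ 2 + 1)) => //.
- exact: leq_trans hN.
- by rewrite openC.
- by lra.
move=> x Sx; split.
  move=> /(HB (B + 1)) /= => /(_ ltac:(by rewrite ltrDl)) xB.
  have : `|x| ^+ 2 <= (B + 1) ^+ 2 by rewrite lerXn2r ?nnegrE // (le_trans _ xB).
  move=> /(ler_wpM2l (ler0n R N)); have := sqnorm_le x; lra.
rewrite -esq; apply: HA; apply: HM; rewrite ltNge; apply/negP => xM.
have : enorm x ^+ 2 <= M ^+ 2.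
  by rewrite lerXn2r ?nnegrE ?(le_trans _ xM) ?sqrtr_ge0.
by rewrite esq; lra.
Qed.
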